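(* Let $H$ be a finite group and let $K,L$ be Cayley objects over $H$. If $\mathrm{Aut}(K)\prec_{H_R}\mathrm{Aut}(L)$, then every solving set for $K$ is a solving set for $L$. In particular, if $K$ is a CI-object over $H$, then so is $L$.
   Context: Permutations act on the right and compose left to right; for $X\le\mathrm{Sym}(\Omega)$ and $g\in\mathrm{Sym}(\Omega)$, $X^g=g^{-1}Xg$. $H_R\le\mathrm{Sym}(H)$ is the group of right translations $x\mapsto xh$, $h\in H$. A combinatorial object on $H$ (e.g. a relational structure, colored digraph, or linear code in $\mathbb{F}_q^H$) is acted upon by $\mathrm{Sym}(H)$, $K\mapsto K^g$; $\mathrm{Aut}(K)=\{g:K^g=K\}$, and a Cayley object over $H$ is an object with $H_R\le\mathrm{Aut}(K)$. A set $S\subseteq\mathrm{Sym}(H)$ is a solving set for a Cayley object $K$ if every Cayley object $K'$ over $H$ with $K'=K^g$ for some $g\in\mathrm{Sym}(H)$ satisfies $K'=K^s$ for some $s\in S$; $K$ is a CI-object if every such $K'$ satisfies $K'=K^\sigma$ for some group automorphism $\sigma\in\mathrm{Aut}(H)$ (viewed as a permutation of $H$). For subgroups $X\le Y\le Z\le\mathrm{Sym}(\Omega)$, $Y$ controls fusion of $X$ in $Z$, written $Y\prec_X Z$, if for every $g\in\mathrm{Sym}(\Omega)$ with $X^g\le Z$ there exists $z\in Z$ with $X^{gz}\le Y$. *)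

(* Defs.v *)
From mathcomp Require Import all_boot all_fingroup.
From mathcomp Require Import boolp.

Set Implicit Arguments.
Unset Strict Implicit.
Unset Printing Implicit Defensive.

Local Open Scope group_scope.

(* Products of permutations in MathComp compose left to right, and            *)
(* X :^ g = g^-1 X g, so no convention has to be translated below.            *)

(* Y controls fusion of X in Z; the chain X <= Y <= Z is part of the notion. *)
Definition controls_fusion (Omega : finType) (X Y Z : {group {perm Omega}}) :=
  [/\ X \subset Y, Y \subset Z &
      forall g : {perm Omega}, X :^ g \subset Z ->
        exists2 z : {perm Omega}, z \in Z & X :^ (g * z) \subset Y].

Definition right_translations (H : finGroupType) : {group {perm H}} :=
  (actperm 'R @* [set: H])%G.

Lemma mem_right_translations (H : finGroupType) (g : {perm H}) :
  reflect (exists h : H, forall x : H, g x = x * h)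
          (g \in right_translations H).
Proof.
apply: (iffP morphimP) => [[h _ _ ->] | [h gE]].
  by exists h => x; rewrite actpermE.
by exists h; rewrite ?inE //; apply/permP=> x; rewrite actpermE gE.
Qed.

(* A kind of combinatorial object on H (relational structures, colored        *)
(* digraphs, codes, ...) is a type T of objects with a right action of Sym(H);*)
(* K^g is to K g. T is an arbitrary Type, hence the classical comprehension. *)
Section CayleyObjects.

Variables (H : finGroupType) (T : Type) (to : {action {perm H} &-> T}).
Implicit Types (K : T) (S : {set {perm H}}).

Definition obj_aut_set K : {set {perm H}} := [set g | `[< to K g = K >]].

Lemma obj_aut_group_set K : group_set (obj_aut_set K).
Proof.
have [to_inj toM] : is_action [set: {perm H}] to by case: to.
apply/group_setP; split=> [|g h]; rewrite !inE.
  by apply/asboolP/(to_inj 1); rewrite -toM ?inE // mulg1.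
by move=> /asboolP Kg /asboolP Kh; apply/asboolP; rewrite toM ?inE // Kg.
Qed.

Definition obj_aut K : {group {perm H}} := Group (obj_aut_group_set K).

Definition cayley_object K := right_translations H \subset obj_aut K.

Definition solving_set K S :=
  forall K' : T, cayley_object K' ->
    (exists g : {perm H}, K' = to K g) -> exists2 s, s \in S & K' = to K s.

Definition CI_object K :=
  forall K' : T, cayley_object K' ->
    (exists g : {perm H}, K' = to K g) ->
    exists2 sigma, sigma \in Aut [set: H] & K' = to K sigma.

End CayleyObjects.

(* Main.v *)
Require Import Defs.
From mathcomp Require Import all_boot all_fingroup.
From mathcomp Require Import boolp.

Local Open Scope group_scope.

(** If [L^g] is Cayley then [H_R^(g^-1) <= Aut L], so fusion control yields
    [z] in [Aut L] with [H_R^(g^-1 z) <= Aut K], i.e. [K^(z^-1 g)] is Cayley.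
    A solving set for [K] contains [s] with [K^(z^-1 g) = K^s]; then
    [z^-1 g s^-1] fixes [K], hence [L], and [L^g = L^(z^-1 g) = L^s]. *)

Section ObjectAutomorphisms.

Variables (H : finGroupType) (T : Type) (to : {action {perm H} &-> T}).

(* [actM] and [act1] of MathComp are stated for actions on a [finType] only. *)
Lemma obj_actM (K : T) (g h : {perm H}) : to K (g * h) = to (to K g) h.
Proof. by case: to => f [/= _ fM]; apply: fM; rewrite inE. Qed.

Lemma obj_act1 (K : T) : to K 1 = K.
Proof.
have [to_inj _] : is_action [set: {perm H}] to by case: to.
by apply: (to_inj 1); rewrite -obj_actM mulg1.
Qed.

Lemma obj_autP (K : T) (g : {perm H}) :
  reflect (to K g = K) (g \in obj_aut to K).
Proof. by rewrite inE; apply: asboolP. Qed.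

(** Turns equality of two images of [K] into group membership, which an inclusion of automorphism
    groups carries to another object. *)
Lemma obj_act_eqP (K : T) (g h : {perm H}) :
  to K g = to K h <-> g * h^-1 \in obj_aut to K.
Proof.
split=> [Kgh | /obj_autP KghV].
  by apply/obj_autP; rewrite obj_actM Kgh -obj_actM mulgV obj_act1.
by rewrite -[g](mulgKV h) obj_actM KghV.
Qed.

(** [h] fixes [K^g] iff [K^(g h) = K^g], that is, iff [g h g^-1] fixes [K]. *)
Lemma obj_aut_act (K : T) (g : {perm H}) :
  obj_aut to (to K g) = obj_aut to K :^ g :> {set {perm H}}.
Proof.
apply/setP=> h; rewrite mem_conjg conjgE invgK mulgA.
by apply/obj_autP/idP=> [|/obj_act_eqP]; rewrite -obj_actM // => /obj_act_eqP.
Qed.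

(** Gives the form of the premise of fusion control, at [g^-1]. *)
Lemma cayley_object_act (K : T) (g : {perm H}) :
  cayley_object to (to K g) =
  (right_translations H :^ g^-1 \subset obj_aut to K).
Proof. by rewrite /cayley_object obj_aut_act sub_conjgV. Qed.

End ObjectAutomorphisms.

Theorem theorem3p4 (H : finGroupType) (TK TL : Type)
    (actK : {action {perm H} &-> TK}) (actL : {action {perm H} &-> TL})
    (K : TK) (L : TL)
    (cayK : cayley_object actK K) (cayL : cayley_object actL L)
    (fusion : controls_fusion (right_translations H) (obj_aut actK K) (obj_aut actL L)) :
  (forall S : {set {perm H}}, solving_set actK K S -> solving_set actL L S)
  /\ (CI_object actK K -> CI_object actL L).
Proof.
have solvingKL (S : {set {perm H}}) :
    solving_set actK K S -> solving_set actL L S.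
  move=> solK L' cayL' [g defL']; move: cayL'; rewrite defL' cayley_object_act.
  case: fusion => _ /subsetP sKL fus /fus[z Lz HKgz].
  (* The conjugator to check is [(z^-1 g)^-1 = g^-1 z], as in [HKgz]. *)
  have cayKzg : cayley_object actK (actK K (z^-1 * g)).
    by rewrite cayley_object_act invMg invgK.
  have [s Ss /obj_act_eqP/sKL/obj_act_eqP defLs] :=
    solK _ cayKzg (ex_intro _ _ erefl).
  by exists s; rewrite // -defLs obj_actM; move: Lz; rewrite -groupV => /obj_autP->.
(* [CI_object] unfolds to [solving_set] for the set [Aut [set: H]]. *)
by split=> //; apply: solvingKL.
Qed.
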